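(* Let $M$ be a closed manifold, let $F,G\in C(M)$ be two continuous real-valued functions on $M$, and let $\zeta$ be a simple quasi-state on $M$. Put $\Pi(F,G)=|\zeta(F+G)-\zeta(F)-\zeta(G)|$. Then the image of the map $\Phi: M\to\mathbb{R}^2$, $\Phi(x)=(F(x),G(x))$, contains the convex hull of the three points $$(\zeta(F),\zeta(G)),\qquad (\zeta(F),\ \zeta(F+G)-\zeta(F)),\qquad (\zeta(F+G)-\zeta(G),\ \zeta(G)).$$ This convex hull is an isosceles right triangle whose legs are of length $\Pi(F,G)$.
   Context: A closed manifold is a compact smooth manifold without boundary. For a compact Hausdorff space $X$, $C(X)$ is the algebra of real-valued continuous functions on $X$ with the supremum norm, and for $F\in C(X)$, $C(F)=\{\varphi\circ F \mid \varphi\in C(F(X))\}$ is the closed subalgebra generated by $F$ and the constant $1$. A quasi-state on $X$ is a (not necessarily linear) functional $\zeta: C(X)\to\mathbb{R}$ such that (i) $\zeta(F)\ge 0$ whenever $F\ge 0$; (ii) $\zeta$ is linear on $C(F)$ for every $F\in C(X)$; (iii) $\zeta(1)=1$. A quasi-state is simple if it is multiplicative on $C(F)$ for every $F\in C(X)$. When $\Pi(F,G)=0$ the triangle is understood as degenerate (a single point). *)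

(* Defs.v *)
From HB Require Import structures.
From mathcomp Require Import all_boot all_order all_algebra.
From mathcomp Require Import all_classical all_reals all_analysis.

Set Implicit Arguments.
Unset Strict Implicit.
Unset Printing Implicit Defensive.

Import Order.TTheory GRing.Theory Num.Theory.
Import numFieldNormedType.Exports.

Local Open Scope classical_set_scope.
Local Open Scope ring_scope.

Section ClosedManifold.
Context {R : realType}.

(* [f] is meaningful only on the open set [U]: its values elsewhere, and those
   of its derivatives, are irrelevant. *)
Fixpoint is_Ck (k n m : nat) (U : set 'rV[R]_n) (f : 'rV[R]_n -> 'rV[R]_m)
    {struct k} : Prop :=
  {within U, continuous f} /\
  if k is k'.+1 then
    forall i : 'I_n, (forall x, U x -> derivable f x (delta_mx 0 i)) /\
                     is_Ck k' U ('D_(delta_mx 0 i) f)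
  else True.

Definition smooth_on (n m : nat) (U : set 'rV[R]_n)
    (f : 'rV[R]_n -> 'rV[R]_m) : Prop :=
  forall k, is_Ck k U f.

(* A homeomorphism from an open subset of [M] onto an open subset of R^n;
   [chart_map] and [chart_inv] are arbitrary outside these two sets. *)
Record chart (n : nat) (M : topologicalType) := Chart {
  chart_dom : set M;
  chart_map : M -> 'rV[R]_n;
  chart_inv : 'rV[R]_n -> M;
  chart_dom_open : open chart_dom;
  chart_img_open : open (chart_map @` chart_dom);
  chart_map_cts : {within chart_dom, continuous chart_map};
  chart_inv_cts : {within chart_map @` chart_dom, continuous chart_inv};
  chart_mapK : forall x, chart_dom x -> chart_inv (chart_map x) = x
}.

Definition compatible (n : nat) (M : topologicalType) (c d : chart n M) : Prop :=
  smooth_on (chart_map c @` (chart_dom c `&` chart_dom d))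
            (chart_map d \o chart_inv c).

Record closed_manifold (n : nat) := ClosedManifold {
  cm_carrier :> topologicalType;
  cm_hausdorff : hausdorff_space cm_carrier;
  cm_second_countable : @second_countable cm_carrier;
  cm_compact : compact [set: cm_carrier];
  cm_atlas : set (chart n cm_carrier);
  cm_cover : forall x : cm_carrier, exists2 c, cm_atlas c & chart_dom c x;
  cm_compatible : forall c d, cm_atlas c -> cm_atlas d -> compatible c d
}.

End ClosedManifold.

Arguments closed_manifold R n : clear implicits.
Arguments chart R n M : clear implicits.

Section ContinuousFunctions.
Context {R : realType} {X : topologicalType}.
Implicit Types F G : continuousType X R.

Lemma continuous_add_fun F G : continuous (F \+ G : X -> R).
Proof. by move=> x; apply: cvgD; exact: cts_fun. Qed.

Lemma continuous_mul_fun F G : continuous (F \* G : X -> R).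
Proof. by move=> x; apply: cvgM; exact: cts_fun. Qed.

HB.instance Definition _ F G :=
  @isContinuous.Build X R (F \+ G) (@continuous_add_fun F G).
HB.instance Definition _ F G :=
  @isContinuous.Build X R (F \* G) (@continuous_mul_fun F G).

End ContinuousFunctions.

Section QuasiState.
Context {R : realType} {X : topologicalType}.
Implicit Types (F G H : continuousType X R) (zeta : continuousType X R -> R).

(* The subalgebra C(F) = {phi o F | phi in C(F(X))} of C(X). *)
Definition generated_subalgebra F : set (continuousType X R) :=
  [set G | exists2 phi : R -> R,
     {within range F, continuous phi} & (G : X -> R) = phi \o F].

Record quasi_state zeta : Prop := QuasiState {
  qs_pos : forall F, (forall x, 0 <= F x) -> 0 <= zeta F;
  qs_linear : forall F G H (a : R),
    generated_subalgebra F G -> generated_subalgebra F H ->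
    zeta (cst a \* G \+ H) = a * zeta G + zeta H;
  qs_one : zeta (cst 1) = 1
}.

Record simple_quasi_state zeta : Prop := SimpleQuasiState {
  sqs_quasi_state :> quasi_state zeta;
  sqs_mult : forall F G H,
    generated_subalgebra F G -> generated_subalgebra F H ->
    zeta (G \* H) = zeta G * zeta H
}.

Definition Pi zeta F G : R := `|zeta (F \+ G) - zeta F - zeta G|.

End QuasiState.

Section Plane.
Context {R : realType}.

(* [R^o] rather than [R], so that the product is a vector space over [R]. *)
Definition plane : lmodType R := (R^o * R^o)%type.

Definition dot (p q : plane) : R := p.1 * q.1 + p.2 * q.2.

(* The norm that the library puts on a product is the sup norm. *)
Definition euclidean_dist (p q : plane) : R := Num.sqrt (dot (q - p) (q - p)).

Definition convex_hull (S : set plane) : set plane :=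
  smallest (@convex_set R plane) S.

(* The right angle is at [A]. When [l = 0] the three vertices coincide and the
   triangle degenerates to a point. *)
Definition isosceles_right_triangle (T : set plane) (l : R) : Prop :=
  exists A B C : plane,
    [/\ T = convex_hull [set A; B; C],
        dot (B - A) (C - A) = 0,
        euclidean_dist A B = l &
        euclidean_dist A C = l].

End Plane.

Arguments plane R : clear implicits.

(* Main.v *)
Require Import Defs.
From mathcomp Require Import all_boot all_order all_algebra.
From mathcomp Require Import all_classical all_reals all_analysis.
From mathcomp Require Import ring lra.

Import Order.TTheory GRing.Theory Num.Theory numFieldNormedType.Exports.

Local Open Scope classical_set_scope.
Local Open Scope ring_scope.

(** For a simple quasi-state zeta, any two functions F and G take the values
    zeta F and zeta G at a common point. Let P and Q satisfy
    zeta P, zeta Q >= 0 >= zeta (P + Q), and suppose that they have no common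
    zero. The function g = min(P, 0) - min(Q, 0) has zeta g = 0, and its zero
    set splits into a part where P + Q is bounded below by some d > 0 (P and Q
    both nonnegative) and one where P + Q <= -d (P = Q < 0). A function f equal
    to d on the first part, to -d on the second, and of absolute value < d
    elsewhere must have zeta f = d or zeta f = -d. In the first case f = d is
    attained where P + Q = zeta (P + Q) <= 0, in the second f = -d is attained
    where P = zeta P >= 0; both are impossible. Applying this to F - p.1 and
    G - p.2, or to their opposites, puts every point p of the triangle in the
    image. *)

Lemma compact_lower_bound (R : realType) (X : topologicalType) (f : X -> R) :
  compact [set: X] -> continuous f -> (forall x, 0 < f x) ->
  exists2 d : R, 0 < d & forall x, d <= f x.
Proof.
move=> cX cf f0; have [X0|/set0P X0] := eqVneq [set: X] set0.
  by exists 1 => // x; have : [set: X] x by []; rewrite X0.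
have [c _ cmin] := compact_EVT_min X0 cX (continuous_subspaceT cf).
by exists (f c) => // x; apply: cmin; rewrite inE.
Qed.

(** * Closure properties of the algebra generated by one function *)

Section GeneratedSubalgebra.
Context {R : realType} {X : topologicalType}.
Implicit Types F G H : continuousType X R.

Lemma generated_self F : generated_subalgebra F F.
Proof. by exists idfun => //; apply: continuous_subspaceT => x; exact: cvg_id. Qed.

Lemma generated_cst F (a : R) : generated_subalgebra F (cst a).
Proof. by exists (cst a) => // x; exact: cvg_cst. Qed.

Lemma generatedD F G H : generated_subalgebra F G ->
  generated_subalgebra F H -> generated_subalgebra F (G \+ H).
Proof.
case=> p cp Gp [q cq Hq]; exists (p \+ q).
  by move=> x; apply: cvgD; [exact: cp|exact: cq].
by rewrite /= Gp Hq.
Qed.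

Lemma generatedM F G H : generated_subalgebra F G ->
  generated_subalgebra F H -> generated_subalgebra F (G \* H).
Proof.
case=> p cp Gp [q cq Hq]; exists (p \* q).
  by move=> x; apply: cvgM; [exact: cp|exact: cq].
by rewrite /= Gp Hq.
Qed.

End GeneratedSubalgebra.

(** * Values of a simple quasi-state on a compact space *)

Section SimpleQuasiState.
Context {R : realType} {X : topologicalType}.
Variable zeta : continuousType X R -> R.
Hypothesis cX : compact [set: X].
Hypothesis hz : simple_quasi_state zeta.
Implicit Types F G H P Q : continuousType X R.

(** The constant is written [cst a \* cst 1] to match the linear combinations of [qs_linear]
    literally. *)
Lemma qs_shift F (a : R) : zeta (cst a \* cst 1 \+ F) = a + zeta F.
Proof.
rewrite (qs_linear hz a (generated_cst F 1) (generated_self F)) (qs_one hz).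
by rewrite mulr1.
Qed.

(* Otherwise (F - zeta F)^2 + (H - zeta H)^2, whose value under zeta is 0 by
   multiplicativity, is bounded below by a positive constant. *)
Lemma sqs_comp (phi : R -> R) F H : continuous phi -> H =1 phi \o F ->
  zeta H = phi (zeta F).
Proof.
move=> cphi HE; apply/eqP/negPn/negP => /eqP ne.
have gH : generated_subalgebra F H.
  by exists phi; [exact: continuous_subspaceT|exact/funext].
set D1 : continuousType X R := cst (- zeta F) \* cst 1 \+ F.
set D2 : continuousType X R := cst (- zeta H) \* cst 1 \+ H.
have z1 : zeta D1 = 0 by rewrite qs_shift addNr.
have z2 : zeta D2 = 0 by rewrite qs_shift addNr.
have g1 : generated_subalgebra F D1.
  apply: generatedD (generated_self F).
  by apply: generatedM; exact: generated_cst.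
have g2 : generated_subalgebra F D2.
  apply: generatedD gH.
  by apply: generatedM; exact: generated_cst.
set E : continuousType X R := cst 1 \* (D1 \* D1) \+ (D2 \* D2).
have zE : zeta E = 0.
  rewrite (qs_linear hz 1 (generatedM _ _ _ g1 g1) (generatedM _ _ _ g2 g2)).
  by rewrite !(sqs_mult hz (F := F))// z1 z2 !mulr0 addr0.
have [d d0 dE] : exists2 d : R, 0 < d & forall x, d <= E x.
  apply: compact_lower_bound => //; first exact: cts_fun.
  move=> x; rewrite /E /D1 /D2 /cst /= mul1r !mulr1 -!expr2 lt_neqAle.
  rewrite addr_ge0 ?sqr_ge0// andbT eq_sym paddr_eq0 ?sqr_ge0// !sqrf_eq0.
  rewrite !(addrC (- _)) !subr_eq0; apply/negP => /andP[/eqP h1 /eqP h2].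
  by apply: ne; rewrite -h2 HE /= h1.
(* [E - d] is nonnegative, yet [zeta] sends it to [- d < 0]. *)
have := qs_pos hz (F := cst (- d) \* cst 1 \+ E).
rewrite qs_shift zE => /(_ _)/wrap[x|].
  by rewrite /cst /= mulr1 addrC subr_ge0; exact: dE.
by lra.
Qed.

Lemma sqs_mkcts_comp (phi : R -> R) F (c : continuous (phi \o F)) :
  continuous phi -> zeta (mkcts c) = phi (zeta F).
Proof. by move=> cphi; exact: sqs_comp. Qed.

(* If F and G had no such point, min(|G - zeta G|, e) and
   e - min(|F - zeta F|, e) would, for small e, be the functions min(L, e) and
   max(L - e, 0) of their sum L; but zeta maps them to 0 and e. *)
Lemma sqs_joint_value F G : exists x, F x = zeta F /\ G x = zeta G.
Proof.
apply/not_existsP => noX.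
have cF := @cts_fun _ _ F; have cG := @cts_fun _ _ G.
have [d d0 dH] : exists2 d : R, 0 < d &
    forall x, d <= `|F x - zeta F| + `|G x - zeta G|.
  apply: (compact_lower_bound _ _ (fun x => `|F x - zeta F| + `|G x - zeta G|)) => //.
    by move=> x; apply: cvgD; apply: cvg_norm; apply: cvgB;
      [exact: cF|exact: cvg_cst|exact: cG|exact: cvg_cst].
  move=> x; rewrite lt_neqAle addr_ge0// andbT eq_sym paddr_eq0//.
  rewrite !normr_eq0 !subr_eq0; apply/negP => /andP[/eqP h1 /eqP h2].
  exact: (noX x).
(* With half of [d], at every point at least one of the two distances is [>= e]. So one truncation
   is always saturated, and [L] is [<= e] or [>= e] accordingly. *)
pose e := d / 2; have e0 : 0 < e by rewrite /e; lra.
pose dist_min (a y : R) := Num.min `|y - a| e.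
have cdist a : continuous (dist_min a).
  move=> y; apply: (@continuous_min R R (fun y => `|y - a|) (cst e)).
    by apply: cvg_norm; apply: cvgB; [exact: cvg_id|exact: cvg_cst].
  exact: cvg_cst.
pose p y := e - dist_min (zeta F) y.
have cp : continuous p.
  by move=> y; apply: cvgB; [exact: cvg_cst|exact: cdist].
have cpF : continuous (p \o F).
  by move=> x; apply: continuous_comp; [exact: cF|exact: cp].
have cqG : continuous (dist_min (zeta G) \o G).
  by move=> x; apply: continuous_comp; [exact: cG|exact: cdist].
have cL : continuous ((p \o F) \+ (dist_min (zeta G) \o G)).
  by move=> x; apply: cvgD; [exact: cpF|exact: cqG].
have cmn : continuous (fun y : R => Num.min y e).
  move=> y; apply: (@continuous_min R R id (cst e)); first exact: cvg_id.
  exact: cvg_cst.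
have cmx : continuous (fun y : R => Num.max (y - e) 0).
  move=> y; apply: (@continuous_max R R (fun y => y - e) (cst 0)).
    by apply: cvgB; [exact: cvg_id|exact: cvg_cst].
  exact: cvg_cst.
have h1 : zeta (mkcts cpF) = Num.max (zeta (mkcts cL) - e) 0.
  apply: (sqs_comp (fun y => Num.max (y - e) 0) (mkcts cL)) => // x.
  rewrite /= /mkcts /= /p /dist_min.
  have := dH x; rewrite (_ : d = e + e); last by rewrite /e; lra.
  have := normr_ge0 (F x - zeta F); have := normr_ge0 (G x - zeta G).
  move: `|F x - _| `|G x - _| => u v ? ? ?.
  by case: (leP u e) => ?; case: (leP v e) => ?; case: leP; lra.
have h2 : zeta (mkcts cqG) = Num.min (zeta (mkcts cL)) e.
  apply: (sqs_comp (fun y => Num.min y e) (mkcts cL)) => // x.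
  rewrite /= /mkcts /= /p /dist_min.
  have := dH x; rewrite (_ : d = e + e); last by rewrite /e; lra.
  have := normr_ge0 (F x - zeta F); have := normr_ge0 (G x - zeta G).
  move: `|F x - _| `|G x - _| => u v ? ? ?.
  by case: (leP u e) => ?; case: (leP v e) => ?; case: leP; lra.
(* The first identity forces [zeta L = 2 e], the second [zeta L = 0]. *)
move: h1 h2; rewrite !sqs_mkcts_comp// /p /dist_min !subrr normr0.
by rewrite (min_l (ltW e0)); case: leP => ?; case: leP; lra.
Qed.

Lemma sqs_common_zero P Q : 0 <= zeta P -> 0 <= zeta Q -> zeta (P \+ Q) <= 0 ->
  exists x, P x = 0 /\ Q x = 0.
Proof.
move=> P0 Q0 W0; apply/not_existsP => noX.
have cP := @cts_fun _ _ P; have cQ := @cts_fun _ _ Q.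
have [d d0 dH] : exists2 d : R, 0 < d & forall x, d <= `|P x| + `|Q x|.
  apply: (compact_lower_bound _ _ (fun x => `|P x| + `|Q x|)) => //.
    by move=> x; apply: cvgD; apply: cvg_norm; [exact: cP|exact: cQ].
  move=> x; rewrite lt_neqAle addr_ge0// andbT eq_sym paddr_eq0//.
  rewrite !normr_eq0; apply/negP => /andP[/eqP h1 /eqP h2].
  exact: (noX x).
pose g x := Num.min (P x) 0 - Num.min (Q x) 0.
have cg : continuous g.
  move=> x; apply: cvgB.
    by apply: (@continuous_min R X P (cst 0)); [exact: cP|exact: cvg_cst].
  by apply: (@continuous_min R X Q (cst 0)); [exact: cQ|exact: cvg_cst].
have zg : zeta (mkcts cg) = 0.
  (* Where [P = zeta P >= 0], [g] is nonnegative; where [Q = zeta Q >= 0], it is nonpositive. Both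
     values equal [zeta g]. *)
  have [x []] := sqs_joint_value (mkcts cg) P.
  have [y []] := sqs_joint_value (mkcts cg) Q.
  rewrite /= /mkcts /g => <- Qy zgx Px.
  move: zgx P0 Q0; rewrite -Qy -Px => + Px0 Qy0.
  by rewrite (min_r Px0) (min_r Qy0); case: leP => ?; case: leP; lra.
(* [A] reaches its maximum [d] exactly on the zero set of [g]. Below, [f] is [P + Q] clamped to
   [[- A, A]], so [f = d] or [f = - d] forces [g = 0]. *)
pose A x := Num.max (d - `|g x|) 0.
have cA : continuous A.
  move=> x; apply: (@continuous_max R X (fun x => d - `|g x|) (cst 0)).
    by apply: cvgB; [exact: cvg_cst|apply: cvg_norm; exact: cg].
  exact: cvg_cst.
pose f x := Num.max (- A x) (Num.min (A x) (P x + Q x)).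
have cf : continuous f.
  move=> x; apply: (@continuous_max R X (fun x => - A x)
    (fun x => Num.min (A x) (P x + Q x))).
    by apply: cvgN; exact: cA.
  apply: (@continuous_min R X A (fun x => P x + Q x)); first exact: cA.
  by apply: cvgD; [exact: cP|exact: cQ].
have A0 x : 0 <= A x by rewrite /A le_max lexx orbT.
have Ad x : A x >= d -> A x = d /\ g x = 0.
  rewrite /A; have n0 := normr_ge0 (g x).
  case: (leP _ 0) => [|_] dd; first by lra.
  have n1 : `|g x| = 0 by lra.
  by split; [lra|exact/normr0_eq0].
have zf : zeta (mkcts cf) = d \/ zeta (mkcts cf) = - d.
  have [x []] := sqs_joint_value (mkcts cf) (mkcts cg).
  rewrite zg /= /mkcts => <- gx.
  (* Where [g = 0], [P] and [Q] have no opposite signs, so [|P + Q| = |P| + |Q| >= d] and the clamp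
     gives [d] or [- d]. *)
  have Ax : A x = d by rewrite /A gx normr0 subr0 max_l// ltW.
  rewrite /f Ax; move: gx (dH x); rewrite /g.
  case: (leP (P x) 0) => hP; case: (leP (Q x) 0) => hQ gx;
    rewrite ?(ler0_norm hP) ?(gtr0_norm hP) ?(ler0_norm hQ) ?(gtr0_norm hQ) => dx;
    case: (leP d (P x + Q x)) => hw; case: leP => hv; lra.
case: zf => zf.
  have [x []] := sqs_joint_value (mkcts cf) (P \+ Q).
  rewrite zf /= /mkcts /= /f => fx wx.
  have Ax := A0 x; move: W0 fx; rewrite -wx => ?.
  by case: (leP (A x) _) => ?; case: leP; lra.
have [x []] := sqs_joint_value (mkcts cf) P.
rewrite zf /= /mkcts /f => fx Px.
have [Ax gx] : A x = d /\ g x = 0.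
  by apply: Ad; have Ax := A0 x; move: fx; case: (leP (A x) _) => ?;
    case: (leP (- A x) _); lra.
move: P0 gx fx; rewrite /g -Px Ax => Px0; rewrite (min_r Px0).
by case: (leP (Q x) 0) => ? ?; case: (leP d _) => ?; case: leP; lra.
Qed.

End SimpleQuasiState.

(** * Half-planes containing the triangle *)

(** A closed half-plane is convex, and the hull is the smallest convex set around [S]. *)
Lemma convex_hull_le (R : realType) (S : set (plane R)) (u v k : R) :
  (forall q, S q -> u * q.1 + v * q.2 <= k) ->
  forall p, convex_hull S p -> u * p.1 + v * p.2 <= k.
Proof.
move=> Sk; apply: smallest_sub; last exact: Sk.
move=> x y t; rewrite !inE /= => xk yk.
have -> : u * (t%:num * x.1 + (1 - t%:num) * y.1) +
    v * (t%:num * x.2 + (1 - t%:num) * y.2) =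
  t%:num * (u * x.1 + v * x.2) + (1 - t%:num) * (u * y.1 + v * y.2) by ring.
have t0 : 0 <= t%:num by [].
have t1 : t%:num <= 1 by [].
by nra.
Qed.

(** The sides lie on the lines [p.1 = a], [p.2 = b] and [p.1 + p.2 = c]; the sign of [c - (a + b)]
    decides on which side of the right angle the hypotenuse falls. *)
Lemma right_triangle_le (R : realType) (a b c : R) (p : plane R) :
  convex_hull [set (a, b); (a, c - a); (c - b, b)] p ->
  [/\ p.1 <= a, p.2 <= b & c <= p.1 + p.2] \/
  [/\ a <= p.1, b <= p.2 & p.1 + p.2 <= c].
Proof.
move=> Tp; have half u v k h := convex_hull_le R _ u v k h p Tp.
have [c_le|c_gt] := leP c (a + b); [left|right].
- have h1 : 1 * p.1 + 0 * p.2 <= a by apply: half => q [[->|->]|->] /=; lra.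
  have h2 : 0 * p.1 + 1 * p.2 <= b by apply: half => q [[->|->]|->] /=; lra.
  have h3 : -1 * p.1 + -1 * p.2 <= - c.
    by apply: half => q [[->|->]|->] /=; lra.
  by split; lra.
- have h1 : -1 * p.1 + 0 * p.2 <= - a.
    by apply: half => q [[->|->]|->] /=; lra.
  have h2 : 0 * p.1 + -1 * p.2 <= - b.
    by apply: half => q [[->|->]|->] /=; lra.
  have h3 : 1 * p.1 + 1 * p.2 <= c by apply: half => q [[->|->]|->] /=; lra.
  by split; lra.
Qed.

Theorem theorem1p1 (R : realType) (n : nat) (M : closed_manifold R n)
    (F G : continuousType M R) (zeta : continuousType M R -> R)
    (hzeta : simple_quasi_state zeta) :
  let Phi : M -> plane R := fun x => (F x, G x) in
  let T : set (plane R) :=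
    convex_hull [set (zeta F, zeta G);
                     (zeta F, zeta (F \+ G) - zeta F);
                     (zeta (F \+ G) - zeta G, zeta G)] in
  T `<=` range Phi /\ isosceles_right_triangle T (Pi zeta F G).
Proof.
move=> Phi T.
have cM := @cm_compact R n M.
split; last first.
  exists (zeta F, zeta G), (zeta F, zeta (F \+ G) - zeta F),
    (zeta (F \+ G) - zeta G, zeta G).
  rewrite /euclidean_dist /dot /Pi /=; split => //.
  - by rewrite !subrr mulr0 mul0r addr0.
  - by rewrite subrr mulr0 add0r -expr2 sqrtr_sqr.
  - by rewrite subrr mulr0 addr0 -expr2 sqrtr_sqr addrAC.
move=> p Tp.
suff [x [Fx Gx]] : exists x, F x = p.1 /\ G x = p.2.
  by exists x => //; rewrite /Phi Fx Gx; case: (p).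
have cN (H : continuousType M R) (k : R) : continuous ((fun y => k - y) \o H).
  by move=> x; apply: cvgB; [exact: cvg_cst|exact: (@cts_fun _ _ H x)].
have cB (k : R) : continuous (fun y : R => k - y).
  by move=> y; apply: cvgB; [exact: cvg_cst|exact: cvg_id].
case: (right_triangle_le _ _ _ _ _ Tp) => -[h1 h2 h3].
- have [|||x [Px Qx]] := sqs_common_zero _ cM hzeta
      (cst (- p.1) \* cst 1 \+ F) (cst (- p.2) \* cst 1 \+ G).
  + by rewrite qs_shift// addrC subr_ge0.
  + by rewrite qs_shift// addrC subr_ge0.
  (* Additivity may fail for [F] and [G], but the sum of the two shifted functions is a function of
     [F \+ G] alone. *)
  + rewrite (sqs_comp _ cM hzeta (fun y => y - (p.1 + p.2)) (F \+ G)).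
    * by rewrite subr_le0.
    * by move=> y; apply: cvgB; [exact: cvg_id|exact: cvg_cst].
    * by move=> x; rewrite /cst /=; ring.
  by exists x; move: Px Qx; rewrite /cst /=; split; lra.
- have [|||x [Px Qx]] :=
      sqs_common_zero _ cM hzeta (mkcts (cN F p.1)) (mkcts (cN G p.2)).
  + by rewrite sqs_mkcts_comp// subr_ge0.
  + by rewrite sqs_mkcts_comp// subr_ge0.
  + rewrite (sqs_comp _ cM hzeta (fun y => (p.1 + p.2) - y) (F \+ G)) //.
      by rewrite subr_le0.
    by move=> x; rewrite /= /mkcts /=; ring.
  by exists x; move: Px Qx; rewrite /= /mkcts /=; split; lra.
Qed.
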